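(* Let $p$ be an integer coprime to a positive integer $q$. For odd $r\ge 3$, the linear operator $RT_r(C_{p,q}):RT_r(T^2)\to RT_r(T^2)$ is invertible if and only if $r$ and $q$ are coprime. Moreover, the operator norm $|||RT_r(C_{p,q})^{-1}|||$ grows at most polynomially in $r$: there exist $C>0$ and $N\in\mathbb{N}$ such that $|||RT_r(C_{p,q})^{-1}|||\le Cr^N$ for all odd $r\ge 3$ coprime to $q$.
   Context: Let $r=2m+1\ge 3$ be odd and $A$ (depending on $r$) a primitive $2r$-th root of unity. $RT_r(T^2)$ is the $m$-dimensional complex Hermitian space associated with the torus by the $SO_3$ Reshetikhin--Turaev TQFT, with orthonormal basis $e_1,\dots,e_m$ ($e_i$ is the core of the solid torus colored by the $(i-1)$-th Jones--Wenzl idempotent). Vectors $e_i$ are defined for all $i\in\mathbb{Z}$ by $e_{-i}=-e_i$ and $e_{i+kr}=(-1)^ke_i$ for $k\in\mathbb{Z}$ (so $e_0=e_r=0$ and $e_{r-i}=e_i$). $C_{p,q}$ is the $(p,q)$-cable space: the complement of the torus knot $T_{p,q}$ of slope $p/q$, lying on the boundary of the standard solid torus $V\subset S^3$, in a slightly larger solid torus $V'$. Regarded as a cobordism between tori it yields the operator $RT_r(C_{p,q})$, given explicitly by Morton's cabling formula: for $1\le i\le m$, $$RT_r(C_{p,q})(e_i)=A^{pq(i^2-1)/2}\sum_{k\in S_i}A^{-2pk(qk+1)}e_{2qk+1},\qquad S_i=\Big\{-\tfrac{i-1}{2},-\tfrac{i-3}{2},\dots,\tfrac{i-3}{2},\tfrac{i-1}{2}\Big\}.$$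 (The total exponent of $A$ in each term is an integer.) $|||\cdot|||$ is the operator norm with respect to the Hermitian norm for which $e_1,\dots,e_m$ is orthonormal.
   Formalization: The invertibility equivalence is stated for all odd r ≥ 3 except r = 3 with 3 dividing q, where it is false: there RT_3(T^2) is a line and the operator is the identity, hence invertible although r and q are not coprime. *)

(* Defs.v *)
From HB Require Import structures.
From mathcomp Require Import all_boot all_order all_algebra.
From mathcomp Require Import classical_sets reals complex.
From mathcomp Require Import ring lra zify.

Set Implicit Arguments.
Unset Strict Implicit.
Unset Printing Implicit Defensive.

Import Order.TTheory GRing.Theory Num.Theory.
Local Open Scope classical_set_scope.
Local Open Scope ring_scope.

(* RT_r(T^2), r = 2m+1, is modelled by the column vectors 'cV[R[i]]_(r./2) over
   the complex numbers R[i]; r./2 = m, and the orthonormal basis e_1, ..., e_m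
   is the canonical one, e_(a+1) being delta_mx a 0 for a : 'I_(r./2). *)

Section OperatorNorm.
Variables (R : realType) (n : nat).

Definition herm_norm (v : 'cV[R[i]]_n) : R :=
  Num.sqrt (\sum_a Normc.normc (v a 0) ^+ 2).

Definition op_norm (M : 'M[R[i]]_n) : R :=
  sup [set herm_norm (M *m v) | v in [set v | herm_norm v <= 1]].

End OperatorNorm.

Section CableOperator.
Variables (R : realType) (r : nat).

(* e_n for n : int: writing n = k r + s with 0 <= s < r, it is (-1)^k e_s, where
   e_0 = 0 and e_s = e_(r-s). Lemmas torus_vec_basis, torus_vecN and
   torus_vecDr below are the defining relations. *)
Definition torus_vec (n : int) : 'cV[R[i]]_(r./2) :=
  let s := `|(n %% r)%Z|%N in
  \col_a ((-1) ^ (n %/ r)%Z * (a.+1 == minn s (r - s) :> nat)%:R).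

(* The elements k of S_i are half-integers; we enumerate l = 2k. *)
Definition cable_idx (i t : nat) : int := t%:Z *+ 2 - (i%:Z - 1).

(* pq(i^2-1)/2 - 2pk(qk+1) with l = 2k; the division is exact when l and i have
   opposite parities, see cable_expE. *)
Definition cable_exp (p : int) (q i : nat) (l : int) : int :=
  ((p * q%:Z * (i%:Z ^+ 2 - 1 - l ^+ 2)) %/ 2)%Z - p * l.

Definition cable_image (A : R[i]) (p : int) (q i : nat) : 'cV[R[i]]_(r./2) :=
  \sum_(t < i) A ^ cable_exp p q i (cable_idx i t)
                 *: torus_vec (q%:Z * cable_idx i t + 1).

Definition cable_op (A : R[i]) (p : int) (q : nat) : 'M[R[i]]_(r./2) :=
  \matrix_(a, j) cable_image A p q j.+1 a 0.

End CableOperator.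

Lemma cable_expE (p : int) (q i t : nat) :
  let k : rat := t%:R - (i%:R - 1) / 2 in
  (cable_exp p q i (cable_idx i t))%:~R
  = p%:~R * q%:R * (i%:R ^+ 2 - 1) / 2 - 2 * p%:~R * k * (q%:R * k + 1) :> rat.
Proof.
move=> k; rewrite /cable_exp.
set l := cable_idx i t.
have lE : l%:~R = 2 * k :> rat.
  by rewrite /l /cable_idx /k !rmorphB rmorphMn /= -!pmulrn rmorph1; field.
have [x hx] : exists x : int, i%:Z ^+ 2 - 1 - l ^+ 2 = x * 2.
  exists (i%:Z *+ 2 * t%:Z + i%:Z - 1 - t%:Z ^+ 2 *+ 2 - t%:Z *+ 2).
  by rewrite /l /cable_idx; ring.
have hxQ : (i%:R ^+ 2 - 1 - (2 * k) ^+ 2) = x%:~R * 2 :> rat.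
  have := congr1 (fun z : int => z%:~R : rat) hx.
  by rewrite /= !rmorphB /= !rmorphXn rmorphM /= lE rmorph1 -!pmulrn.
rewrite hx mulrA mulzK // rmorphB !rmorphM /= lE -pmulrn.
have -> : x%:~R = (i%:R ^+ 2 - 1 - (2 * k) ^+ 2) / 2 :> rat by rewrite hxQ; field.
by field.
Qed.

Section TorusVec.
Variables (R : realType) (r : nat).
Hypothesis r_odd : odd r.
Let r_gt0 : (0 < r)%N. Proof. by case: r r_odd. Qed.
Let rZ : r%:Z != 0. Proof. by case: r r_odd. Qed.

Lemma torus_vec_basis (a : 'I_(r./2)) :
  torus_vec R r a.+1%:Z = delta_mx a 0.
Proof.
have ha := ltn_ord a; have ho := odd_double_half r; rewrite r_odd in ho.
apply/matrixP => b c; rewrite ord1 !mxE eqxx andbT.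
have lt : (a.+1 < r)%N by lia.
rewrite !modz_nat !divz_nat /= modn_small // divn_small //.
rewrite expr0z mul1r.
have -> : minn a.+1 (r - a.+1) = a.+1 by lia.
by rewrite eqSS.
Qed.

Lemma torus_vecDr (n k : int) :
  torus_vec R r (n + k * r%:Z) = (-1) ^ k *: torus_vec R r n.
Proof.
apply/matrixP => b c; rewrite !mxE addrC modzMDl divzMDl //.
by rewrite expfzDr ?oppr_eq0 ?oner_eq0 // mulrA.
Qed.

Lemma torus_vecN (n : int) : torus_vec R r (- n) = - torus_vec R r n.
Proof.
have N10 : -1 != 0 :> R[i] by rewrite oppr_eq0 oner_eq0.
rewrite (divz_eq n r) addrC opprD -mulNr !torus_vecDr -scalerN.
have -> : (-1) ^ (- (n %/ r)%Z) = (-1) ^ (n %/ r)%Z :> R[i].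
  by rewrite -exprz_inv invrN1.
congr (_ *: _).
have s_ge0 := modz_ge0 n rZ.
have s_lt : ((n %% r)%Z < r%:Z) by apply: ltz_pmod.
move: s_ge0 s_lt; case: (n %% r)%Z => // s _ s_lt.
have {}s_lt : (s < r)%N by lia.
case: s s_lt => [|s] s_lt.
  rewrite oppr0; apply/matrixP => b c; rewrite !mxE mod0z /=.
  by rewrite min0n mulr0 oppr0.
have -> : - (s.+1)%:Z = (r - s.+1)%N%:Z + (-1) * r%:Z by lia.
rewrite torus_vecDr; apply/matrixP => b c; rewrite !mxE.
rewrite !modz_nat !divz_nat /= !modn_small ?divn_small //; try lia.
rewrite !expr0z !mul1r subKn ?(ltnW s_lt) // minnC.
by rewrite exprN1 invrN1 mulN1r.
Qed.

End TorusVec.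

Section OperatorNormTheory.
Variables (R : realType) (n : nat).
Implicit Types (v : 'cV[R[i]]_n) (M : 'M[R[i]]_n).

Let normc_ge0 (z : R[i]) : 0 <= Normc.normc z.
Proof. by case: z => x y; apply: sqrtr_ge0. Qed.

Let normc_sum (I : finType) (F : I -> R[i]) :
  Normc.normc (\sum_i F i) <= \sum_i Normc.normc (F i).
Proof.
apply: (big_ind2 (fun z x => Normc.normc z <= x)) => //.
  by rewrite Normc.normc0.
move=> z x z' x' h h'; apply: le_trans (le_normcD _ _) _; exact: lerD.
Qed.

Let normc_le_herm_norm v a : Normc.normc (v a 0) <= herm_norm v.
Proof.
rewrite -[leLHS](ger0_norm (normc_ge0 _)) -sqrtr_sqr ler_wsqrtr //.
by rewrite (bigD1 a) //= lerDl; apply: sumr_ge0 => b _; apply: sqr_ge0.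
Qed.

Let herm_norm0 : herm_norm (0 : 'cV[R[i]]_n) = 0.
Proof.
rewrite /herm_norm big1 ?sqrtr0 // => a _.
by rewrite mxE Normc.normc0 expr0n.
Qed.

Let herm_normZ (x : R) v : 0 <= x ->
  herm_norm (x%:C%C *: v) = x * herm_norm v.
Proof.
move=> x0; rewrite -[X in X * _](ger0_norm x0) -sqrtr_sqr -sqrtrM ?sqr_ge0 //.
congr Num.sqrt; rewrite mulr_sumr; apply: eq_bigr => a _.
rewrite mxE Normc.normcM exprMn; congr (_ * _).
by rewrite /= expr0n addr0 sqr_sqrtr ?sqr_ge0.
Qed.

Lemma herm_norm_dotmx v :
  ((herm_norm v ^+ 2)%:C)%C = dotmx v^T v^T.
Proof.
rewrite dotmxE mxE sqr_sqrtr; last by apply: sumr_ge0 => a _; apply: sqr_ge0.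
rewrite rmorph_sum; apply: eq_bigr => a _.
rewrite !mxE -normCK rmorphXn /=; congr (_ ^+ 2).
Qed.

(* The set whose supremum is op_norm is nonempty and bounded, so that sup takes
   no junk value. *)
Lemma has_sup_op_norm M :
  has_sup [set herm_norm (M *m v) | v in [set v | herm_norm v <= 1]].
Proof.
split; first by exists (herm_norm (M *m 0)), 0 => //=; rewrite herm_norm0.
exists (Num.sqrt (\sum_a (\sum_b Normc.normc (M a b)) ^+ 2)).
move=> _ [v /= hv <-]; rewrite ler_wsqrtr //.
apply: ler_sum => a _.
have S0 : 0 <= \sum_b Normc.normc (M a b).
  by apply: sumr_ge0 => b _; apply: normc_ge0.
apply: lerXn2r; rewrite ?nnegrE ?normc_ge0 // mxE.
apply: le_trans (normc_sum _) _.
apply: ler_sum => b _; rewrite Normc.normcM ler_piMr ?normc_ge0 //.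
exact: le_trans (normc_le_herm_norm v b) hv.
Qed.

Lemma op_norm_ub M v : herm_norm (M *m v) <= op_norm M * herm_norm v.
Proof.
have [v0|v0] := eqVneq (herm_norm v) 0.
  have -> : v = 0.
    apply/matrixP => a c; rewrite ord1 mxE; apply: Normc.eq0_normc.
    by apply/le_anti; rewrite normc_ge0 -v0 normc_le_herm_norm.
  by rewrite mulmx0 herm_norm0 mulr0.
have v_gt0 : 0 < herm_norm v by rewrite lt_neqAle eq_sym v0 sqrtr_ge0.
rewrite -ler_pdivrMr // mulrC.
have iv : 0 <= (herm_norm v)^-1 by rewrite invr_ge0 ltW.
rewrite -herm_normZ // scalemxAr.
apply: (ub_le_sup (has_sup_op_norm M).2).
by exists (((herm_norm v)^-1)%:C%C *: v) => //=; rewrite herm_normZ // mulVf.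
Qed.

End OperatorNormTheory.

(* The equivalence "cable_op is invertible iff r and q are coprime" fails for
   r = 3 when 3 divides q: the space is then a line, on which the operator is
   the identity. *)
Lemma cable_op3 (R : realType) (A : R[i]) (p : int) (q : nat) :
  cable_op 3 A p q = 1%:M.
Proof.
apply/matrixP => a j; rewrite mxE.
have -> : j = ord0 :> 'I_1 by rewrite ord1.
have -> : a = ord0 :> 'I_1 by rewrite ord1.
rewrite /cable_image (big_ord1 _ (fun t => A ^ _ *: _)).
have -> : cable_idx 1 (ord0 : 'I_1) = 0 by [].
have -> : cable_exp p q 1 0 = 0.
  by rewrite /cable_exp -[_ - 1 - _]/(0 : int) !mulr0 div0z.
rewrite expr0z scale1r mulr0 add0r.
by rewrite (@torus_vec_basis R 3 isT ord0) !mxE.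
Qed.

(* Main.v *)
Require Import Defs.
From mathcomp Require Import all_boot all_order all_algebra.
From mathcomp Require Import classical_sets reals complex.
From mathcomp Require Import ring lra zify.

(* Since [(-A)^r = 1] with [r] odd, [A = - B^2] for some [B] with [B^r = 1]. If [q] has
   an inverse [q'] modulo [r], then [-p q l^2 / 2 - p l] is, up to a term that
   depends only on [i], half of [-p q' ((q l + 1)^2 - 1)], so [A] contributes only
   diagonal unitary factors: the operator is [D1 Psi_q D2], where [Psi_q] maps
   [e_i] to the sum of the [e_(q l + 1)] (with signs making [e] [r]-periodic).
   From [Psi_q (e_(n+1) - e_(n-1)) = e_(q n + 1) - e_(q n - 1)] one gets
   [Psi_q' Psi_q = 1], and the entries of [Psi_q'] are at most [r/2] in modulus.
   If [d = gcd(r, q) > 1], some row of the matrix vanishes. *)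

Import Order.TTheory GRing.Theory Num.Theory.
Local Open Scope ring_scope.

(** * Odd periodic functions on the integers and Adams operations *)

Section OddPeriodic.
Variables (F : numFieldType) (r : nat).
Hypotheses (r_odd : odd r) (r_gt1 : (1 < r)%N).
Implicit Types (f g : int -> F) (q n : int).

Let rZ : r%:Z != 0. Proof. by case: r r_odd. Qed.

Lemma modz_ord n : exists2 s : nat, (s < r)%N & (n %% r)%Z = s%:Z.
Proof.
have s_ge0 := modz_ge0 n rZ.
exists `|(n %% r)%Z|%N; last by rewrite gez0_abs.
by rewrite -ltz_nat gez0_abs // ltz_pmod // ltz_nat; lia.
Qed.

Definition odd_periodic f :=
  (forall n, f (- n) = - f n) /\ (forall n k, f (n + k * r%:Z) = f n).

Lemma eq_opp0 (x : F) : x = - x -> x = 0.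
Proof. by move/eqP; rewrite -subr_eq0 opprK -mulr2n mulrn_eq0 /= => /eqP. Qed.

Lemma odd_periodic0 f : odd_periodic f -> f 0 = 0.
Proof. by case=> fN _; apply: eq_opp0; rewrite -fN oppr0. Qed.

Lemma odd_periodic_modz f n : odd_periodic f -> f (n %% r)%Z = f n.
Proof. by case=> _ fD; rewrite {2}(divz_eq n r) addrC fD. Qed.

(** The residues [0, 1, ..., r./2] and their negatives exhaust the integers modulo the odd number
    [r]. *)
Lemma odd_periodic_ext f g : odd_periodic f -> odd_periodic g ->
  (forall a : 'I_(r./2), f a.+1%:Z = g a.+1%:Z) -> f =1 g.
Proof.
move=> hf hg fg n.
rewrite -(odd_periodic_modz _ n hf) -(odd_periodic_modz _ n hg).
have [s s_lt ->] := modz_ord n.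
have small k : (k <= r./2)%N -> f k%:Z = g k%:Z.
  case: k => [|k] hk; first by rewrite !odd_periodic0.
  exact: (fg (Ordinal hk)).
have [/small//|hs] := leqP s r./2.
have hk : (r - s <= r./2)%N by move: r_odd; lia.
have {small}e := small _ hk.
have -> : s%:Z = - (r - s)%N%:Z + 1 * r%:Z by lia.
by rewrite hf.2 hg.2 hf.1 hg.1 e.
Qed.

(** By oddness the difference at [0] gives [2 f 1 = 2 g 1]; the later differences then propagate
    equality in steps of two. *)
Lemma eq_odd_periodic_diff f g : odd_periodic f -> odd_periodic g ->
  (forall n, f (n + 1) - f (n - 1) = g (n + 1) - g (n - 1)) -> f =1 g.
Proof.
move=> hf hg fg.
suff H (k : nat) : f k%:Z = g k%:Z /\ f k.+1%:Z = g k.+1%:Z.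
  by apply: odd_periodic_ext => // a; case: (H a).
elim: k => [|k [IH1 IH2]].
  split; first by rewrite !odd_periodic0.
  have /eqP := fg 0; rewrite add0r sub0r hf.1 hg.1 !opprK -!mulr2n.
  by rewrite -subr_eq0 -mulrnBl mulrn_eq0 /= subr_eq0 => /eqP.
split=> //; have := fg k.+1%:Z.
have -> : k.+1%:Z - 1 = k by lia.
have -> : k.+1%:Z + 1 = k.+2 by lia.
by rewrite IH1 => /addIr.
Qed.

Lemma sum_periodic_reflect f (s : int) :
  (forall n k, f (n + k * r%:Z) = f n) ->
  \sum_(t < r) f (s - t%:Z) = \sum_(t < r) f t%:Z.
Proof.
move=> fD; pose h (t : 'I_r) : nat := `|((s - t%:Z) %% r)%Z|%N.
have hE t : (h t)%:Z = ((s - t%:Z) %% r)%Z.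
  by rewrite /h gez0_abs // modz_ge0.
have hlt t : (h t < r)%N.
  by rewrite -ltz_nat hE ltz_pmod //; move: r_odd; lia.
pose k t : 'I_r := Ordinal (hlt t).
have kK : involutive k.
  move=> t; apply: val_inj; apply/eqP; rewrite -(eqr_nat int) !natz /= hE /= hE.
  apply/eqP; rewrite -modzDmr modzNm modzDmr.
  have -> : s - (s - t%:Z) = t by ring.
  by rewrite modz_nat modn_small.
rewrite [RHS](reindex_inj (inv_inj kK)); apply: eq_bigr => t _ /=.
rewrite hE {1}(divz_eq (s - t%:Z) r) addrC; exact: fD.
Qed.

(* With [e_i] read as the character [(x^i - x^-i)/(x - x^-1)] and [f] as a linear
   form on characters, this is [f] at the image of [e_i] under [x |-> x^q]. *)
Definition adams_sum q f (i : nat) : F :=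
  \sum_(t < i) f (q * cable_idx i t + 1).

(** Reducing [n] modulo [r] gives a function on all integers, so that two such operations can be
    composed. Oddness is then to be proved, from an inverse of [q] modulo [r]. *)
Definition adams q f n : F := adams_sum q f `|(n %% r)%Z|%N.

(** Going from [i] to [i + 2] only adds the extreme indices [i + 1] and [-(i + 1)]; oddness of [f]
    gives the minus sign to the second one. *)
Lemma adams_sumS q f (i : nat) : odd_periodic f ->
  adams_sum q f i.+2 - adams_sum q f i
  = f (q * i.+1%:Z + 1) - f (q * i.+1%:Z - 1).
Proof.
case=> fN fD; rewrite /adams_sum big_ord_recl big_ord_recr /=.
have -> : \sum_(t < i) f (q * cable_idx i.+2 (lift ord0 (widen_ord (leqnSn i) t)) + 1)
  = \sum_(t < i) f (q * cable_idx i t + 1).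
  by apply: eq_bigr => t _; congr f; rewrite /cable_idx /= /bump /=; lia.
have -> : q * cable_idx i.+2 0 + 1 = - (q * i.+1%:Z - 1).
  by rewrite /cable_idx; lia.
have -> : q * cable_idx i.+2 (lift ord0 (@ord_max i)) + 1 = q * i.+1%:Z + 1.
  by rewrite /cable_idx /= /bump /=; lia.
by rewrite fN; ring.
Qed.

Section Coprime.
Variables (q q' c : int).
Hypothesis qq' : q * q' = 1 + c * r%:Z.

(** The reflection of [t] in [- q' * d] negates the argument of [f] modulo [r], so the sum over a
    period equals its own opposite. *)
Lemma sum_adams_period f d : odd_periodic f ->
  \sum_(t < r) f (q * (t%:Z *+ 2) + d) = 0.
Proof.
case=> fN fD; apply: eq_opp0.
pose g (t : int) := f (q * (t *+ 2) + d).
rewrite -{1}(@sum_periodic_reflect g (- q' * d)).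
  rewrite -sumrN; apply: eq_bigr => t _; rewrite /g -fN.
  have -> : q * ((- q' * d - t%:Z) *+ 2) + d
    = - (q * (t%:Z *+ 2) + d) + (- (d * c) *+ 2) * r%:Z.
    have -> : q * ((- q' * d - t%:Z) *+ 2) + d
       = - (q * q') * (d *+ 2) - q * (t%:Z *+ 2) + d by ring.
    by rewrite qq'; ring.
  exact: fD.
move=> n k; rewrite /g; have -> : q * ((n + k * r%:Z) *+ 2) + d
  = q * (n *+ 2) + d + (q * k *+ 2) * r%:Z by ring.
exact: fD.
Qed.

(** The indices for [r - i], followed by those for [i] shifted by [r], form one progression of step
    2 and length [r], over which [f] sums to zero. *)
Lemma adams_sum_subr f (i : nat) : (i <= r)%N -> odd_periodic f ->
  adams_sum q f (r - i) = - adams_sum q f i.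
Proof.
move=> ir hf; apply/eqP; rewrite -subr_eq0 opprK; apply/eqP.
rewrite -[RHS](sum_adams_period _ (q * (1 - (r - i)%N%:Z) + 1) hf).
rewrite -(big_mkord xpredT (fun t : nat => f (q * (t%:Z *+ 2) + _))).
rewrite (@big_cat_nat _ _ _ (r - i)) ?leq_subr //= /adams_sum; congr (_ + _).
  rewrite big_mkord; apply: eq_bigr => t _.
  by rewrite /cable_idx; congr f; ring.
rewrite -{1}[(r - i)%N]add0n big_addn subKn // big_mkord.
apply: eq_bigr => t _; rewrite -(hf.2 _ q); congr f.
by rewrite /cable_idx PoszD -(subzn ir); ring.
Qed.

Lemma adams_sum0 f : adams_sum q f 0 = 0.
Proof. by rewrite /adams_sum big_ord0. Qed.

Lemma adams_sum1 f : adams_sum q f 1 = f 1.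
Proof. by rewrite /adams_sum big_ord1 /cable_idx /= mulr0. Qed.

Lemma adams_small f (i : nat) : (i < r)%N -> adams q f i = adams_sum q f i.
Proof. by move=> ir; rewrite /adams modz_nat modn_small. Qed.

Lemma adams_odd_periodic f : odd_periodic f -> odd_periodic (adams q f).
Proof.
move=> hf; split=> [n|n k]; last by rewrite /adams addrC modzMDl.
rewrite /adams -modzNm.
have [s s_lt ->] := modz_ord n.
case: s s_lt => [|s] s_lt; first by rewrite oppr0 mod0z adams_sum0 oppr0.
have -> : - s.+1%:Z = -1 * r%:Z + (r - s.+1)%N%:Z by lia.
rewrite modzMDl modz_nat modn_small /=; last by lia.
by rewrite adams_sum_subr // ltnW.
Qed.

Lemma adams_diff f n : odd_periodic f ->
  adams q f (n + 1) - adams q f (n - 1) = f (q * n + 1) - f (q * n - 1).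
Proof.
move=> hf; have [gN gD] := adams_odd_periodic f hf.
rewrite (divz_eq n r); set k := (n %/ r)%Z.
have [s s_lt ->] := modz_ord n.
have -> : k * r%:Z + s%:Z + 1 = s%:Z + 1 + k * r%:Z by ring.
have -> : k * r%:Z + s%:Z - 1 = s%:Z - 1 + k * r%:Z by ring.
have -> : q * (k * r%:Z + s%:Z) + 1 = q * s%:Z + 1 + q * k * r%:Z by ring.
have -> : q * (k * r%:Z + s%:Z) - 1 = q * s%:Z - 1 + q * k * r%:Z by ring.
rewrite !gD !hf.2; case: s s_lt => [|s] s_lt.
  by rewrite mulr0 !add0r gN hf.1 !opprK adams_small ?adams_sum1.
have -> : s.+1%:Z - 1 = s by lia.
have -> : s.+1%:Z + 1 = s.+2 by lia.
rewrite -adams_sumS // (adams_small _ s); last exact: ltnW.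
(* If [s + 2 = r], [adams] wraps around to the empty sum, while the unreduced sum of length [r]
   vanishes by reflection. *)
congr (_ - _); have [lt|ge] := ltnP s.+2 r; first by rewrite adams_small.
have -> : s.+2 = r by lia.
by rewrite /adams modzz adams_sum0 -[in RHS](subn0 r) adams_sum_subr // adams_sum0 oppr0.
Qed.

End Coprime.

Lemma adamsK (q q' c : int) f : q * q' = 1 + c * r%:Z -> odd_periodic f ->
  adams q (adams q' f) =1 f.
Proof.
move=> qq' hf; have q'q : q' * q = 1 + c * r%:Z by rewrite mulrC.
have hg := adams_odd_periodic _ _ _ q'q _ hf.
apply: eq_odd_periodic_diff => // [|n].
  exact: adams_odd_periodic qq' _ hg.
rewrite (adams_diff _ _ _ qq') // (adams_diff _ _ _ q'q) // mulrA q'q.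
have -> : (1 + c * r%:Z) * n + 1 = n + 1 + c * n * r%:Z by ring.
have -> : (1 + c * r%:Z) * n - 1 = n - 1 + c * n * r%:Z by ring.
by rewrite !hf.2.
Qed.

End OddPeriodic.

(** * Coordinates of the vectors [e_n] *)

Section CableOperator.
Variables (R : realType) (r : nat).
Hypotheses (r_odd : odd r) (r_gt1 : (1 < r)%N).

Let N10 : -1 != 0 :> R[i]. Proof. by rewrite oppr_eq0 oner_eq0. Qed.

Lemma signzD (m n : int) : (-1) ^ (m + n) = (-1) ^ m * (-1) ^ n :> R[i].
Proof. by rewrite expfzDr. Qed.

Lemma eq_signz_mod2 (m n : int) : (exists k, m = n + k *+ 2) ->
  (-1) ^ m = (-1) ^ n :> R[i].
Proof.
case=> k ->; rewrite signzD.
have -> : k *+ 2 = 2 * k by ring.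
by rewrite -exprz_exp -[(-1) ^ 2]/((-1) ^+ 2) sqrrN expr1n exp1rz mulr1.
Qed.

(* The sign makes the coordinates of [e_n] periodic in [n], not only up to sign. *)
Definition torus_coord (a : 'I_(r./2)) (n : int) : R[i] :=
  (-1) ^ n * torus_vec R r n a 0.

Lemma torus_coord_odd_periodic a : odd_periodic _ r (torus_coord a).
Proof.
split=> [n|n k]; rewrite /torus_coord.
  rewrite torus_vecN // mxE mulrN; congr (- (_ * _)).
  by apply: eq_signz_mod2; exists (- n); ring.
rewrite torus_vecDr // mxE mulrA -signzD; congr (_ * _).
(* Both signs together give the exponent [k r + k = 2 k (1 + r./2)], which is even. *)
apply: eq_signz_mod2; exists (k * (1 + r./2%:Z)).
have {1}-> : r%:Z = 1 + 2 * r./2%:Z by have := odd_double_half r; lia.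
by ring.
Qed.

Lemma torus_coord_basis (a b : 'I_(r./2)) :
  torus_coord a b.+1 = (-1) ^+ b.+1 * (a == b)%:R.
Proof. by rewrite /torus_coord torus_vec_basis // mxE eqxx andbT. Qed.

(** Both sides are odd and periodic in [n], so the basis indices suffice; there [(-1) ^+ b.+1]
    undoes the sign put into [torus_coord]. *)
Lemma torus_coord_expand (g : int -> R[i]) n : odd_periodic _ r g ->
  \sum_(b < r./2) g b.+1%:Z * (-1) ^+ b.+1 * torus_coord b n = g n.
Proof.
move=> hg; pose h n := \sum_(b < r./2) g b.+1%:Z * (-1) ^+ b.+1 * torus_coord b n.
rewrite -/(h n); apply: (@odd_periodic_ext _ r) => // [|j].
  split=> [k|k l]; rewrite /h.
    by rewrite -sumrN; apply: eq_bigr => b _; rewrite (torus_coord_odd_periodic b).1 mulrN.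
  by apply: eq_bigr => b _; rewrite (torus_coord_odd_periodic b).2.
rewrite /h (bigD1 j) //= big1 => [|b /negPf bj].
  by rewrite torus_coord_basis eqxx mulr1 addr0 -mulrA -expr2 sqrr_sign mulr1.
by rewrite torus_coord_basis bj !mulr0.
Qed.

Lemma norm_torus_coord a n : `|torus_coord a n| <= 1.
Proof.
have norm_sign (m : int) : `|(-1) ^ m : R[i]| = 1.
  by case: m => k; rewrite ?NegzE -?exprnN ?normfV normrX normrN1 expr1n ?invr1.
rewrite /torus_coord mxE !normrM !norm_sign !mul1r normr_nat.
by case: (_ == _); rewrite ?ler01.
Qed.

(** * Factorization and left inverse when [q] is invertible modulo [r] *)

Section Root.
Variables (A : R[i]) (p : int) (q : nat) (q' c : int).
Hypothesis A_prim : (2 * r)%N.-primitive_root A.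
Hypothesis qq' : q%:Z * q' = 1 + c * r%:Z.

(** Primitivity forces [A ^+ r = -1], so [- A] has odd order and its power [(r + 1) / 2] is a square
    root of it. *)
Lemma prim_root_neg_sqr : exists2 B, B ^+ r = 1 & A = - B ^+ 2.
Proof.
have Ar : A ^+ r = -1.
  have /eqP := prim_expr_order A_prim; rewrite mulnC exprM sqrf_eq1.
  case/orP=> /eqP // Ar1; have := prim_order_dvd A_prim r.
  by rewrite Ar1 eqxx => /dvdn_leq; lia.
have Nr : (- A) ^+ r = 1 by rewrite exprNn Ar -signr_odd r_odd expr1 mulrN1 opprK.
exists ((- A) ^+ (r./2.+1)); first by rewrite -exprM mulnC exprM Nr expr1n.
rewrite -exprM; have -> : (r./2.+1 * 2 = r + 1)%N by lia.
by rewrite exprD Nr mul1r expr1 opprK.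
Qed.

Lemma cable_opE : exists u v : 'I_(r./2) -> R[i],
  [/\ forall a, `|u a| = 1, forall j, `|v j| = 1 &
     forall a j, cable_op r A p q a j
                 = u a * adams _ r q (torus_coord a) j.+1 * v j].
Proof.
have [B Br AB] := prim_root_neg_sqr.
have normB : `|B| = 1.
  have r0 : (0 < r)%N by lia.
  by apply/eqP; rewrite -(pexpr_eq1 r0) // -normrX Br normr1.
have normz (x : R[i]) (n : int) : `|x| = 1 -> `|x ^ n| = 1.
  by move=> x1; case: n => n; rewrite ?NegzE -?exprnN ?normfV normrX x1 expr1n ?invr1.
have B0 : B != 0 by rewrite -normr_eq0 normB oner_eq0.
(* For [n = q l + 1] the exponent is [- p (q l ^ 2 + 2 l)] modulo [r]: the part of twice the cable
   exponent that depends on [l]. *)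
pose mu n := B ^ (- (p * q') * (n ^+ 2 - 1)).
have BrD m k : B ^ (m + k * r%:Z) = B ^ m.
  by rewrite expfzDr // (mulrC k) -exprz_exp -[B ^ r]/(B ^+ r) Br exp1rz mulr1.
have muN n : mu (- n) = mu n by rewrite /mu sqrrN.
have muD n k : mu (n + k * r%:Z) = mu n.
  rewrite /mu; have -> : - (p * q') * ((n + k * r%:Z) ^+ 2 - 1)
   = - (p * q') * (n ^+ 2 - 1)
     + (- (p * q') * (n *+ 2 * k + k ^+ 2 * r%:Z)) * r%:Z by ring.
  exact: BrD.
(* [mu] is even and periodic, and the coordinate vanishes unless [n] is [a + 1] or [-(a + 1)] modulo
   [r], so [mu] becomes a factor of the row. *)
have mu_coord n a : mu n * torus_coord a n = mu a.+1 * torus_coord a n.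
  have [tN tD] := torus_coord_odd_periodic a.
  suff: (fun n => mu n * torus_coord a n)
      =1 (fun n => mu a.+1 * torus_coord a n) by move/(_ n).
  apply: (@odd_periodic_ext _ r) => // [||b].
  - by split=> [k|k l]; rewrite ?muN ?muD ?tN ?tD ?mulrN.
  - by split=> [k|k l]; rewrite ?tN ?tD ?mulrN.
  by rewrite torus_coord_basis; have [->|] := eqVneq a b; rewrite ?mulr0.
pose v (j : nat) : R[i] := (-1) ^ ((p + 1) * q%:Z * j%:Z + p * j%:Z + 1)
  * B ^ (p * q%:Z * (j.+1%:Z ^+ 2 - 1)).
exists (fun a => mu a.+1), (fun j => v j); split=> [a|j|a j].
- exact: normz.
- by rewrite /v normrM !normz ?normrN1 ?mulr1.
rewrite mxE /cable_image summxE adams_small; last by have := ltn_ord j; lia.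
rewrite /adams_sum mulr_sumr mulr_suml; apply: eq_bigr => t _; rewrite mxE.
set l := cable_idx _ _.
set n := q%:Z * l + 1.
rewrite -mu_coord [RHS]mulrC /torus_coord [mu n * _]mulrA [RHS]mulrA; congr (_ * _).
have jE : j.+1%:Z = j%:Z + 1 by lia.
pose x : int := j%:Z - t%:Z ^+ 2 *+ 2 + t%:Z *+ 2 * j%:Z.
have xE : j.+1%:Z ^+ 2 - 1 - l ^+ 2 = x * 2.
  by rewrite /x /l /cable_idx jE; ring.
rewrite /cable_exp xE mulrA mulzK // AB -mulN1r exprzMl ?unitfE ?expf_neq0 //.
set E := _ - _.
(* The parity of [E - n] depends only on [j], since [l] and [x] both have the parity of [j]. *)
have -> : (-1) ^ E = (-1) ^ ((p + 1) * q%:Z * j%:Z + p * j%:Z + 1) * (-1) ^ n :> R[i].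
  rewrite -signzD; apply: eq_signz_mod2.
  exists (- p * q%:Z * t%:Z ^+ 2 + p * q%:Z * t%:Z * j%:Z - p * t%:Z - q%:Z * t%:Z - 1).
  by rewrite /E /x /n /l /cable_idx jE; ring.
have -> : (B ^+ 2) ^ E = B ^ (p * q%:Z * (j.+1%:Z ^+ 2 - 1)) * mu n.
  rewrite -expfzDr // -[B ^+ 2]/(B ^ 2) exprz_exp.
  have -> : - (p * q') * (n ^+ 2 - 1) = - p * (q%:Z * q') * (q%:Z * l ^+ 2 + l *+ 2).
    by rewrite /n; ring.
  rewrite qq' -[RHS](BrD _ (p * c * (q%:Z * l ^+ 2 + l *+ 2))); congr (B ^ _).
  have -> : 2 * E = p * q%:Z * (x * 2) - p * (l *+ 2) by rewrite /E; ring.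
  by rewrite -xE; ring.
by rewrite mulrACA [_ * mu n]mulrC.
Qed.

Lemma cable_op_left_inverse : exists M : 'M[R[i]]_(r./2),
  M *m cable_op r A p q = 1%:M /\ forall a j, `|M a j| <= (r./2)%:R.
Proof.
have [u [v [normu normv ME]]] := cable_opE.
have nz (x : R[i]) : `|x| = 1 -> x != 0 by move=> e; rewrite -normr_eq0 e oner_eq0.
have q'q : q' * q%:Z = 1 + c * r%:Z by rewrite mulrC.
(* This is the operation for [q'] between the inverse diagonal factors; the signs [(-1) ^+ a.+1] and
   [(-1) ^+ j.+1] compensate those of [torus_coord]. *)
exists (\matrix_(a, j) ((-1) ^+ a.+1 / v a
   * adams _ r q' (torus_coord a) j.+1 * ((-1) ^+ j.+1 / u j))).
split=> [|a j]; last first.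
  rewrite !mxE !normrM !normfV !normrX normrN1 !expr1n normu normv !invr1 !mulr1 !mul1r.
  rewrite adams_small; last by have := ltn_ord j; lia.
  apply: le_trans (ler_norm_sum _ _ _) _.
  have hj : ((j.+1)%:R : R[i]) <= (r./2)%:R by rewrite ler_nat.
  apply: le_trans hj; rewrite -[leRHS]mulr1n.
  rewrite -[X in _ <= X%:R](card_ord j.+1) -sumr_const.
  by apply: ler_sum => t _; apply: norm_torus_coord.
apply/matrixP => a j; rewrite mxE [RHS]mxE.
pose g := adams _ r q' (torus_coord a).
have hg : odd_periodic _ r g.
  by apply: adams_odd_periodic => //; first exact: q'q; exact: torus_coord_odd_periodic.
(* The sum over the middle index of the product is the expansion of [g] in the coordinates, taken
   inside [adams_sum]. *)
transitivity ((-1) ^+ a.+1 / v a * adams _ r q g j.+1 * v j).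
  rewrite adams_small; last by have := ltn_ord j; lia.
  rewrite /adams_sum.
  under [in RHS]eq_bigr => t _ do rewrite -(torus_coord_expand g) //.
  rewrite exchange_big mulr_sumr mulr_suml; apply: eq_bigr => b _.
  rewrite mxE ME [adams _ r q%:Z _ _]adams_small; last by have := ltn_ord j; lia.
  rewrite -mulr_sumr -/(g _) /adams_sum.
  by field; rewrite !nz.
rewrite (adamsK _ _ r_odd r_gt1 _ _ _ _ qq') //; last exact: torus_coord_odd_periodic.
rewrite torus_coord_basis; have [->|_] := eqVneq a j; last by rewrite !(mulr0, mul0r).
by rewrite mulr1 mulrAC divfK ?nz // -expr2 sqrr_sign.
Qed.

End Root.

(** * Non-invertibility when [r] and [q] share a factor *)

(* Every [q l + 1] is 1 modulo [d], hence the image lies in the span of the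
   [e_n] with [n = +1 or -1] modulo [d]. *)
Lemma cable_op_row_eq0 (A : R[i]) (p : int) (q d : nat) (a j : 'I_(r./2)) :
  (d %| r)%N -> (d %| q)%N -> ~~ (d %| a)%N -> ~~ (d %| a.+2)%N ->
  cable_op r A p q a j = 0.
Proof.
move=> dr dq da da2; rewrite mxE summxE; apply: big1 => t _; rewrite !mxE.
set n := _ + 1; have [s _ ns] := modz_ord _ r_odd r_gt1 n.
have ds : (d %| s%:Z - 1)%Z.
  have := divz_eq n r; rewrite ns => nE.
  have -> : s%:Z - 1 = q%:Z * cable_idx j.+1 t - (n %/ r)%Z * r%:Z.
    have -> : q%:Z * cable_idx j.+1 t = n - 1 by rewrite /n; ring.
    by rewrite {1}nE; ring.
  by apply: rpredB; [apply: dvdz_mulr | apply: dvdz_mull]; rewrite dvdzE.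
rewrite ns /=; case: eqP => [e|_]; last by rewrite !mulr0.
case: (leqP s (r - s)) e => _ e.
  case/negP: da; move: ds; rewrite -e dvdzE.
  by have -> : a.+1%:Z - 1 = a by lia.
case/negP: da2.
have : (d %| r%:Z - (s%:Z - 1))%Z by rewrite rpredB // dvdzE.
by have -> : r%:Z - (s%:Z - 1) = a.+2 by lia.
Qed.

Lemma cable_op_not_unit (A : R[i]) (p : int) (q : nat) :
  ~ (r = 3%N /\ (3 %| q)%N) -> ~~ coprime r q -> cable_op r A p q \notin unitmx.
Proof.
move=> r3 rq; set d := gcdn r q.
have dr : (d %| r)%N by apply: dvdn_gcdl.
have dq : (d %| q)%N by apply: dvdn_gcdr.
have d_odd : odd d by apply: dvdn_odd dr r_odd.
have d1 : d != 1%N by [].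
have d_gt2 : (2 < d)%N by move: d_odd d1; case: (d) => [|[|[|]]].
have [k rE] := dvdnP dr.
(* A zero row is one whose [a + 1] is neither 1 nor -1 modulo [d]. If [d = r], then [r >= 5] and
   [e_2] qualifies; otherwise [r >= 3 d], and [e_d] is a basis vector with index 0 modulo [d]. *)
have [a [ha ha2]] : exists a : 'I_(r./2), ~~ (d %| a)%N /\ ~~ (d %| a.+2)%N.
  have [k1|k1] := eqVneq k 1%N.
    have rd : r = d by rewrite rE k1 mul1n.
    have r5 : (1 < r./2)%N.
      suff : r != 3%N by move: r_odd; lia.
      by apply/eqP => e; apply: r3; split=> //; rewrite -e rd.
    exists (Ordinal r5) => /=; rewrite -rd; split; apply/negP => /dvdn_leq; lia.
  have k3 : (2 < k)%N.
    move: r_odd k1; rewrite rE oddM => /andP [].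
    by case: (k) => [|[|[|]]].
  have rd3 : (3 * d <= r)%N by rewrite rE leq_mul2r k3 orbT.
  have hd : (d.-1 < r./2)%N by lia.
  exists (Ordinal hd) => /=; split; first by apply/negP => /dvdn_leq; lia.
  have -> : d.-1.+2 = (d + 1)%N by lia.
  by rewrite dvdn_addr // dvdn1.
apply/negP => /mulmxV /matrixP /(_ a a); rewrite !mxE eqxx big1.
  by move/eqP; rewrite eq_sym oner_eq0.
by move=> b _; rewrite (cable_op_row_eq0 _ _ _ _ _ _ dr dq ha ha2) mul0r.
Qed.

End CableOperator.

(** * Operator norm estimate and conclusion *)

(** On the unit ball each coordinate of the image is at most [n K], so its norm is at most
    [sqrt n * n K], rounded up to [n ^ 2 K]. *)
Lemma op_norm_le (R : realType) (n : nat) (M : 'M[R[i]]_n) (K : R) :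
  (forall a b, Normc.normc (M a b) <= K) -> op_norm M <= n%:R ^+ 2 * K.
Proof.
have nc0 (z : R[i]) : 0 <= Normc.normc z by case: z => x y; apply: sqrtr_ge0.
move=> MK; apply: sup_le_ub (has_sup_op_norm M).1 _ => _ [v /= v1 <-].
have vle a : Normc.normc (v a 0) <= 1.
  apply: le_trans v1; rewrite -[leLHS](ger0_norm (nc0 _)) -sqrtr_sqr ler_wsqrtr //.
  by rewrite (bigD1 a) //= lerDl; apply: sumr_ge0 => b _; apply: sqr_ge0.
have ale a : Normc.normc ((M *m v) a 0) <= n%:R * K.
  rewrite mxE.
  have le_sum : Normc.normc (\sum_b M a b * v b 0) <= \sum_b Normc.normc (M a b * v b 0).
    apply: (big_ind2 (fun z x => Normc.normc z <= x)) => //.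
      by rewrite Normc.normc0.
    by move=> z y z' y' h h'; apply: le_trans (le_normcD _ _) _; exact: lerD.
  apply: le_trans le_sum _.
  apply: (@le_trans _ _ (\sum_(b < n) K)); last first.
    by rewrite sumr_const card_ord mulr_natl.
  apply: ler_sum => b _; rewrite Normc.normcM; apply: le_trans (MK a b).
  by rewrite ler_piMr.
(* For [n = 0] the bound on the entries is vacuous and [K] may be negative, but both sides are
   zero. *)
have [n0|n_gt0] := posnP n.
  rewrite /herm_norm big1 ?sqrtr0 => [|a _]; last by exfalso; have := ltn_ord a; lia.
  by rewrite {1}n0 expr0n mul0r.
have K0 : 0 <= K by apply: le_trans (nc0 _) (MK (Ordinal n_gt0) (Ordinal n_gt0)).
have nK : 0 <= n%:R ^+ 2 * K by rewrite mulr_ge0 ?exprn_ge0.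
rewrite -(ger0_norm nK) -sqrtr_sqr ler_wsqrtr //.
apply: (@le_trans _ _ (\sum_(a < n) (n%:R * K) ^+ 2)).
  by apply: ler_sum => a _; apply: lerXn2r; rewrite ?nnegrE ?mulr_ge0.
rewrite sumr_const card_ord -[leLHS]mulr_natl.
have n1 : 1 <= n%:R :> R by rewrite ler1n.
have -> : (n%:R ^+ 2 * K) ^+ 2 = n%:R * (n%:R * (n%:R * K) ^+ 2) by ring.
by rewrite ler_peMl // mulr_ge0 ?sqr_ge0.
Qed.

Lemma coprime_inverse (r q : nat) : coprime r q ->
  exists q' c : int, q%:Z * q' = 1 + c * r%:Z.
Proof.
rewrite -[coprime r q]/(coprimez r q) => /coprimezP [[u v] /= e].
by exists v, (- u); rewrite -e; ring.
Qed.

Theorem theorem1p7 (R : realType) (p : int) (q : nat)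
    (q_gt0 : (0 < q)%N) (coprime_pq : coprimez p q%:Z)
    (A : nat -> R[i])
    (A_prim : forall r, odd r -> (3 <= r)%N -> (2 * r)%N.-primitive_root (A r)) :
  (forall r, odd r -> (3 <= r)%N -> ~ (r = 3%N /\ (3 %| q)%N) ->
     (cable_op r (A r) p q \in unitmx <-> coprime r q)) /\
  (exists (C : R) (N : nat), 0 < C /\
     forall r, odd r -> (3 <= r)%N -> coprime r q ->
       op_norm (invmx (cable_op r (A r) p q)) <= C * r%:R ^+ N).
Proof.
have linv r : odd r -> (3 <= r)%N -> coprime r q -> exists M : 'M[R[i]]_(r./2),
    M *m cable_op r (A r) p q = 1%:M /\ forall a j, `|M a j| <= (r./2)%:R.
  move=> r_odd r3 /coprime_inverse [q' [c qq']].
  exact: cable_op_left_inverse r_odd (ltnW r3) _ p _ _ _ (A_prim _ r_odd r3) qq'.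
split=> [r r_odd r3 r3q|].
  split=> [|/(linv r r_odd r3) [M [/mulmx1_unit [] //]]].
  apply: contraLR; exact: cable_op_not_unit r_odd (ltnW r3) _ _ _ r3q.
(* The dimension contributes [(r./2) ^ 2] and the entries of the inverse [r./2], hence the exponent
   3. *)
exists 1, 3%N; split=> [|r r_odd r3 rq]; first exact: ltr01.
have [M [MV Mle]] := linv r r_odd r3 rq.
have [_ cu] := mulmx1_unit MV.
have -> : invmx (cable_op r (A r) p q) = M.
  by rewrite -[RHS](mulmxK cu) MV mul1mx.
apply: le_trans (op_norm_le _ _ _ (r./2)%:R _) _.
  move=> a b; rewrite -lecR rmorph_nat; exact: Mle.
rewrite mul1r -exprSr lerXn2r ?nnegrE ?ler0n // ler_nat.
by move: r_odd; lia.
Qed.
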